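(* For every real $\varepsilon>0$, there is a constant $C(\varepsilon)$ such that, for every positive integer $n$, every bipartite graph $G$ on $n$ vertices with maximum degree $2$ admits an ordering $\mathcal{G}$ of $G$ that is contained (as an ordered subgraph) in every ordered graph with $N:=C(\varepsilon)n$ vertices and with at least $\varepsilon N^2$ edges.
   Context: An ordered graph is a pair $\mathcal{G}=(G,\prec)$ where $G$ is a (simple) graph and $\prec$ is a total ordering of its vertices; $\mathcal{G}$ is called an ordering of $G$. Two ordered graphs are isomorphic if there is a graph isomorphism between them preserving the vertex orderings. An ordered graph $\mathcal{G}$ is contained in an ordered graph $\mathcal{H}=(H,\prec)$ if $\mathcal{G}$ is isomorphic to some ordered graph $(G',\prec')$ with $G'$ a subgraph of $H$ and $\prec'$ the restriction of $\prec$ to $V(G')$. The convention is that floor and ceiling signs are omitted when not crucial (so $N=C(\varepsilon)n$ is understood as an integer). *)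

(* Defs.v *)
From mathcomp Require Import all_boot.

Set Implicit Arguments.
Unset Strict Implicit.
Unset Printing Implicit Defensive.

Record sgraph := SGraph {
  svertex :> finType;
  sedge : rel svertex;
  sedge_sym : symmetric sedge;
  sedge_irr : irreflexive sedge
}.

Notation "x -- y" := (sedge x y) (at level 30).

Definition edges (G : sgraph) : {set {set G}} :=
  [set [set p.1; p.2] | p : G * G & p.1 -- p.2].

Definition degree (G : sgraph) (x : G) : nat := #|[set y | x -- y]|.

Definition max_degree (G : sgraph) : nat := \max_(x : G) degree x.

Definition bipartite (G : sgraph) : Prop :=
  exists A : {set G}, forall x y : G, x -- y -> (x \in A) != (y \in A).

(* Vertex orders are given in reflexive form. *)
Record vertex_order (G : sgraph) := VertexOrder {
  vle :> rel G;
  vle_total : total vle;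
  vle_anti : antisymmetric vle;
  vle_trans : transitive vle
}.

Record ograph := OGraph {
  ugraph :> sgraph;
  oorder : vertex_order ugraph
}.

(* Subgraphs need not be induced. *)
Record subgraph (H : sgraph) := Subgraph {
  sub_vertices : {set H};
  sub_edge : rel H;
  sub_edge_sym : symmetric sub_edge;
  sub_edge_vertex : forall x y, sub_edge x y -> x \in sub_vertices;
  sub_edge_edge : subrel sub_edge (@sedge H)
}.

Definition subgraph_vertex (H : sgraph) (S : subgraph H) : finType :=
  {x : H | x \in sub_vertices S}.

Definition subgraph_edge (H : sgraph) (S : subgraph H) :
    rel (subgraph_vertex S) :=
  fun x y => sub_edge S (val x) (val y).

Lemma subgraph_edge_sym (H : sgraph) (S : subgraph H) :
  symmetric (@subgraph_edge H S).
Proof. by move=> x y; apply: sub_edge_sym. Qed.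

Lemma subgraph_edge_irr (H : sgraph) (S : subgraph H) :
  irreflexive (@subgraph_edge H S).
Proof.
by move=> x; apply/negP => /(@sub_edge_edge _ _); rewrite sedge_irr.
Qed.

Definition sgraph_of_subgraph (H : sgraph) (S : subgraph H) : sgraph :=
  SGraph (@subgraph_edge_sym H S) (@subgraph_edge_irr H S).

Definition restr_vle (H : sgraph) (S : subgraph H) (o : vertex_order H) :
    rel (sgraph_of_subgraph S) :=
  fun x y => o (val x) (val y).

Lemma restr_vle_total (H : sgraph) (S : subgraph H) (o : vertex_order H) :
  total (@restr_vle H S o).
Proof. by move=> x y; apply: vle_total. Qed.

Lemma restr_vle_anti (H : sgraph) (S : subgraph H) (o : vertex_order H) :
  antisymmetric (@restr_vle H S o).
Proof. by move=> x y le_xy; apply/val_inj/(vle_anti le_xy). Qed.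

Lemma restr_vle_trans (H : sgraph) (S : subgraph H) (o : vertex_order H) :
  transitive (@restr_vle H S o).
Proof. by move=> y x z; apply: vle_trans. Qed.

Definition restr_order (H : sgraph) (S : subgraph H) (o : vertex_order H) :
    vertex_order (sgraph_of_subgraph S) :=
  VertexOrder (@restr_vle_total H S o) (@restr_vle_anti H S o)
    (@restr_vle_trans H S o).

Definition sub_ograph (H : ograph) (S : subgraph H) : ograph :=
  OGraph (restr_order S (oorder H)).

Definition oisomorphic (G H : ograph) : Prop :=
  exists f : G -> H,
    [/\ bijective f,
        forall x y : G, (f x -- f y) = (x -- y)
      & forall x y : G, oorder H (f x) (f y) = oorder G x y].

Definition ocontained (G H : ograph) : Prop :=
  exists S : subgraph H, oisomorphic G (sub_ograph S).

(* Main.v *)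
(* Rows precede columns in the chosen ordering of [G], so that [G] becomes a 0-1
   matrix to be found in a dense matrix.  A cycle of length [2k] is realised as a
   staircase from row [a_0] to column [b_{k-1}], closed up by a row [a_{k-1}]
   below it and a column [b_0] to its left: many 4-cycles share their bottom left
   corner, and the rows and columns they determine contain a staircase of linear
   length, so a dense matrix of side [s >= C k] contains this pattern.  The
   components of [G], paths being completed to cycles, are placed one after the
   other along the diagonal.  If a dense [N x N] matrix did not contain this direct
   sum, the sets of corners [(x, y)] such that [[0, x) x [0, y)] does not contain
   the first [i] summands would cut it into monotone layers; an [s_i x s_i] grid
   block inside the i-th layer is sparse, and the blocks that meet the boundary of
   a layer cover only [O(N s_i)] cells, which makes the whole matrix sparse. *)
Require Import Defs.
From HB Require Import structures.
From mathcomp Require Import all_boot all_order all_algebra zify.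
From mathcomp Require Import boolp reals.

Set Implicit Arguments.
Unset Strict Implicit.
Unset Printing Implicit Defensive.

(** * Counting ones *)

Definition ones (m n : nat) (M : rel nat) : nat :=
  \sum_(x < m) \sum_(y < n) M x y.

Lemma leq_ones m n (P Q : rel nat) :
  (forall x y, x < m -> y < n -> P x y -> Q x y) -> ones m n P <= ones m n Q.
Proof.
move=> PQ; apply: leq_sum => x _; apply: leq_sum => y _.
by case: (P x y) (PQ x y (ltn_ord x) (ltn_ord y)) => // ->.
Qed.

Lemma ones_orW m n (P Q : rel nat) :
  ones m n (fun x y => P x y || Q x y) <= ones m n P + ones m n Q.
Proof.
rewrite /ones -big_split; apply: leq_sum => x _; rewrite -big_split.
by apply: leq_sum => y _; case: (P x y); case: (Q x y).
Qed.

Lemma ones_transpose m n (P : rel nat) : ones m n P = ones n m (fun x y => P y x).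
Proof. exact: exchange_big. Qed.

Lemma ones_row m n c (P : rel nat) :
  (forall x, \sum_(y < n) P x y <= c) -> ones m n P <= m * c.
Proof.
move=> Pc; rewrite -[m in m * c]card_ord -sum_nat_const.
exact: leq_sum.
Qed.

Lemma ones_col m n c (P : rel nat) :
  (forall y, \sum_(x < m) P x y <= c) -> ones m n P <= n * c.
Proof. by move=> Pc; rewrite ones_transpose; apply: ones_row. Qed.

(** All points of [Q] lie in the window of length [s] that starts at the least of them. *)
Lemma sum_window (Q : pred nat) s N :
  (forall x y, Q x -> Q y -> y < x + s) -> \sum_(x < N) Q x <= s.
Proof.
move=> Qs.
have -> : \sum_(x < N) (Q x : nat) = size (filter Q (iota 0 N)).
  rewrite size_filter -sum1_count -(big_mkord predT (fun x => Q x : nat)).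
  by rewrite /index_iota subn0 [RHS]big_mkcond; apply: eq_bigr => x _; case: (Q x).
have [exQ|noQ] := pselect (exists x, Q x); last first.
  rewrite (eq_filter (a2 := pred0)) ?filter_pred0 // => x.
  by apply/negP => Qx; apply: noQ; exists x.
pose m := ex_minn exQ.
rewrite -[s in _ <= s](size_iota m); apply: uniq_leq_size.
  by rewrite filter_uniq ?iota_uniq.
move=> x; rewrite mem_filter !mem_iota => /andP[Qx _].
rewrite /m; case: ex_minnP => z Qz /(_ _ Qx) zx.
apply/andP; split; [exact: zx|exact: Qs].
Qed.

Lemma sum_mul_split s m (F : nat -> nat) :
  \sum_(x < m * s) F x = \sum_(u < m) \sum_(i < s) F (u * s + i).
Proof.
elim: m => [|m IHm]; first by rewrite !big_ord0.
rewrite big_ord_recr /= -IHm -!(big_mkord predT F).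
rewrite -(big_mkord predT (fun i => F (m * s + i))).
rewrite mulSn addnC (big_cat_nat (n := m * s)) ?leq_addr //=; congr (_ + _).
by rewrite -{1}[m * s]add0n big_addn addKn; apply: eq_bigr => i _; rewrite addnC.
Qed.

Lemma ones_blocks s m M :
  ones (m * s) (m * s) M =
  \sum_(u < m) \sum_(v < m) ones s s (fun i j => M (u * s + i) (v * s + j)).
Proof.
rewrite /ones (sum_mul_split s m (fun x => \sum_(y < m * s) M x y)).
apply: eq_bigr => u _; rewrite exchange_big /=.
rewrite (sum_mul_split s m (fun y => \sum_(i < s) M (u * s + i) y)).
by apply: eq_bigr => v _; rewrite exchange_big.
Qed.

Lemma ones_trunc N L (P : rel nat) : N <= L ->
  ones L L (fun x y => [&& x < N, y < N & P x y]) = ones N N P.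
Proof.
move=> NL; rewrite /ones.
rewrite (big_ord_widen L (fun x => \sum_(y < N) P x y)) //= [RHS]big_mkcond.
apply: eq_bigr => x _; case: ifP => [xN|_]; last by rewrite big1 // => y _.
rewrite (big_ord_widen L (fun y => P x y : nat)) //= [RHS]big_mkcond.
by apply: eq_bigr => y _; case: ifP.
Qed.

Lemma ones_all s (P : rel nat) :
  (forall x y, x < s -> y < s -> P x y) -> ones s s P = s * s.
Proof.
move=> Pall; rewrite /ones.
under eq_bigr => x _ do under eq_bigr => y _ do rewrite Pall //.
by rewrite !sum_nat_const !card_ord muln1.
Qed.

(** * Layers between down-closed sets of cells *)

Definition downclosed (A : nat -> nat -> Prop) :=
  forall x y x' y', x' <= x -> y' <= y -> A x y -> A x' y'.

(** Split the diagonal shift into a row shift and a column shift. By monotonicity the cells affected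
    by the row shift form, in each column, a subset of a window of length [s]; symmetrically for the
    column shift in each row. *)
Lemma ones_lower_boundary N s (A : rel nat) : downclosed A ->
  ones N N (fun x y => ~~ A x y && A (x - s) (y - s)) <= 2 * N * s.
Proof.
move=> dA; rewrite -mulnA mul2n -addnn.
pose P x y := ~~ A x y && A (x - s) y.
pose Q x y := ~~ A (x - s) y && A (x - s) (y - s).
apply: (@leq_trans (ones N N (fun x y => P x y || Q x y))).
  apply: leq_ones => x y _ _ /andP[nA A']; rewrite /P /Q nA A' andbT /=.
  exact: orbN.
apply: leq_trans (ones_orW _ _ _ _) _; apply: leq_add.
  apply: ones_col => y; apply: (@sum_window (P ^~ y)) => x x' /andP[nA _] /andP[_ A'].
  rewrite ltnNge; apply: contra nA => xx'; apply: dA A' => //.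
  by rewrite leq_subRL; lia.
apply: ones_row => x; apply: (@sum_window (Q x)) => y y' /andP[nA _] /andP[_ A'].
rewrite ltnNge; apply: contra nA => yy'; apply: dA A' => //.
by rewrite leq_subRL; lia.
Qed.

Lemma ones_upper_boundary N s (A : rel nat) : downclosed A ->
  ones N N (fun x y => A x y && ~~ A (x + s) (y + s)) <= 2 * N * s.
Proof.
move=> dA; rewrite -mulnA mul2n -addnn.
pose P x y := A x y && ~~ A (x + s) y.
pose Q x y := A (x + s) y && ~~ A (x + s) (y + s).
apply: (@leq_trans (ones N N (fun x y => P x y || Q x y))).
  apply: leq_ones => x y _ _ /andP[nA A']; rewrite /P /Q nA A' andbT /=.
  by rewrite orbC orbN.
apply: leq_trans (ones_orW _ _ _ _) _; apply: leq_add.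
  apply: ones_col => y; apply: (@sum_window (P ^~ y)) => x x' /andP[_ nA] /andP[A' _].
  by rewrite ltnNge; apply: contra nA => xx'; apply: dA A'.
apply: ones_row => x; apply: (@sum_window (Q x)) => y y' /andP[_ nA] /andP[A' _].
by rewrite ltnNge; apply: contra nA => yy'; apply: dA A'.
Qed.

Definition shift (M : rel nat) (x y : nat) : rel nat :=
  fun i j => M (x + i) (y + j).

(** Tile the square by blocks of side [s]. A block with near corner outside [A] and far corner
    inside [B] cannot be dense, by the last hypothesis. In every other block, the ones of the layer
    lie on the boundary of [A] or of the truncated [B], and each boundary has at most [2 * N * s]
    cells. *)
Lemma ones_layer (M A B : rel nat) D N s :
  0 < s -> downclosed A -> downclosed B ->
  (forall x y, ~~ A x y -> s * s <= D * ones s s (shift M x y) ->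
     ~~ B (x + s) (y + s)) ->
  D * ones N N (fun x y => [&& M x y, B x y & ~~ A x y]) <=
  ones N N (fun x y => B x y && ~~ A x y) + D * (4 * N * s).
Proof.
move=> s_gt0 dA dB0 dense.
(* Truncating [B] to the square turns the blocks that cross its far sides into boundary blocks of
   [B']. *)
pose B' x y := [&& x < N, y < N & B x y].
have dB : downclosed B'.
  move=> x y x' y' xx yy /and3P[xN yN Bxy].
  by rewrite /B' (leq_ltn_trans xx) ?(leq_ltn_trans yy) //=; apply: dB0 Bxy.
pose W x y := [&& M x y, B' x y & ~~ A x y].
pose V x y := B' x y && ~~ A x y.
pose L1 x y := [&& x < N, y < N & ~~ A x y && A (x - s) (y - s)].
pose L2 x y := [&& x < N, y < N & B' x y && ~~ B' (x + s) (y + s)].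
(* The side is rounded up to a multiple [L] of [s]; all the sets counted below are empty outside the
   original square. *)
pose m := (N %/ s).+1; pose L := m * s.
have NL : N <= L by rewrite ltnW // ltn_ceil.
have -> : ones N N (fun x y => [&& M x y, B x y & ~~ A x y]) = ones L L W.
  rewrite -(ones_trunc _ NL); apply: eq_bigr => x _; apply: eq_bigr => y _.
  by rewrite /W /B'; case: (x < N); case: (y < N); rewrite //= andbF.
have -> : ones N N (fun x y => B x y && ~~ A x y) = ones L L V.
  rewrite -(ones_trunc _ NL); apply: eq_bigr => x _; apply: eq_bigr => y _.
  by rewrite /V /B'; case: (x < N); case: (y < N).
suff main : D * ones L L W <= ones L L V + D * (ones L L L1 + ones L L L2).
  apply: leq_trans main _; rewrite leq_add2l leq_mul2l; apply/orP; right.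
  have := ones_lower_boundary N s dA; have := ones_upper_boundary N s dB.
  rewrite -!(ones_trunc _ NL) => h1 h2.
  by apply: leq_trans (leq_add h2 h1) _; rewrite -mulnDl -mulnDl.
rewrite /L !ones_blocks !big_distrr -!big_split /= big_distrr -big_split /=.
apply: leq_sum => u _; rewrite !big_distrr -!big_split /= big_distrr -big_split /=.
apply: leq_sum => v _; set x := u * s; set y := v * s.
(* If the near corner is in [A], any cell of the block moved back by [s] in both coordinates falls
   into [A]. *)
have [Axy|nAxy] := boolP (A x y).
  apply: leq_trans (leq_addl _ _); rewrite leq_mul2l; apply/orP; right.
  apply: leq_trans (leq_addr _ _); apply: leq_ones => i j i_s j_s.
  move=> /and3P[_ /and3P[xN yN _] nA]; rewrite /L1 xN yN nA /=.
  by apply: dA Axy; lia.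
have [Bxy|nBxy] := boolP (B' (x + s) (y + s)); last first.
  apply: leq_trans (leq_addl _ _); rewrite leq_mul2l; apply/orP; right.
  apply: leq_trans (leq_addl _ _); apply: leq_ones => i j i_s j_s.
  move=> /and3P[_ B'xy nA]; rewrite /L2 B'xy /=; have /and3P[-> -> _] := B'xy.
  by apply: contra nBxy; apply: dB; lia.
(* The block now lies wholly inside the layer: it adds [s * s] to the count of [V], and more than
   that many ones, weighted by [D], would make it dense. *)
apply: leq_trans (leq_addr _ _).
rewrite (@ones_all _ (fun i j => V (x + i) (y + j))); last first.
  move=> i j i_s j_s; apply/andP; split; first by apply: dB Bxy; lia.
  by apply: contra nAxy; apply: dA; lia.
rewrite leqNgt; apply/negP => lt.
have /and3P[_ _ BB] := Bxy; suff: ~~ B (x + s) (y + s) by rewrite BB.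
apply: dense nAxy _.
apply: leq_trans (ltnW lt) _; rewrite leq_mul2l; apply/orP; right.
by apply: leq_ones => i j _ _ /and3P[].
Qed.

(** * Cycles in dense matrices *)

Definition increasing k (a : nat -> nat) :=
  forall i j, i < j -> j < k -> a i < a j.

(** The cells run $(a_0,b_0),(a_1,b_0),(a_1,b_1),\dots,(a_m,b_m)=(x,y)$, consecutive ones sharing a
    column or a row alternately. *)
Definition staircase (W : rel nat) m x y := exists a b : nat -> nat,
  [/\ increasing m.+1 a /\ increasing m.+1 b, a m = x /\ b m = y,
      forall i, i <= m -> W (a i) (b i)
    & forall i, i < m -> W (a i.+1) (b i)].

(** A boolean version of [staircase] whose cells can be counted by [ones]; each recursive call
    removes the last row and the last column. *)
Fixpoint stair_end (W : rel nat) m : rel nat :=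
  if m is m'.+1 then fun x y => W x y &&
    `[< exists x' y', [/\ x' < x, y' < y, W x y' & stair_end W m' x' y'] >]
  else W.

Lemma stair_end_sub W m x y : stair_end W m x y -> W x y.
Proof. by case: m => [//|m] /andP[]. Qed.

Lemma stair_endP W m x y : stair_end W m x y -> staircase W m x y.
Proof.
elim: m x y => [|m IHm] x y.
  move=> Wxy; exists (fun=> x), (fun=> y); split=> //.
  by split=> i j; lia.
move=> /andP[Wxy /asboolP[x' [y' [xx yy Wxy' /IHm]]]].
move=> [a [b [[inca incb] [am bm] Wab Wab']]].
exists (fun i => if i <= m then a i else x), (fun i => if i <= m then b i else y).
split.
- split=> i j ij jm.
    have -> : i <= m by lia.
    case: (leqP j m) => jm'; first by apply: inca.
    apply: leq_ltn_trans xx; rewrite -am; case: (ltngtP i m) => [|| -> //]; last by lia.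
    by move=> im; apply: ltnW; apply: inca.
  have -> : i <= m by lia.
  case: (leqP j m) => jm'; first by apply: incb.
  apply: leq_ltn_trans yy; rewrite -bm; case: (ltngtP i m) => [|| -> //]; last by lia.
  by move=> im; apply: ltnW; apply: incb.
- by rewrite ltnn.
- by move=> i im; case: leqP => // /Wab.
- move=> i im; have -> : i <= m by lia.
  case: (leqP i.+1 m) => im'; first exact: Wab'.
  by have -> : i = m by [lia]; rewrite bm.
Qed.

(* From the ends of the staircases of length [m] discard the topmost one of each
   column, then the leftmost remaining one of each row: what is left ends a
   staircase of length [m.+1]. *)
Lemma ones_not_stair_end W m s :
  ones s s (fun x y => W x y && ~~ stair_end W m x y) <= 2 * m * s.
Proof.
elim: m => [|m IHm].
  by rewrite /ones big1 // => x _; rewrite big1 // => y _ /=; rewrite andbN.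
set E := stair_end W m in IHm.
pose F x y := E x y && `[< exists2 x', x' < x & E x' y >].
pose T x y := E x y && ~~ F x y.
pose L x y := F x y && ~~ `[< exists2 y', y' < y & F x y' >].
have sub : ones s s (fun x y => W x y && ~~ stair_end W m.+1 x y) <=
    ones s s (fun x y => (W x y && ~~ E x y) || (T x y || L x y)).
  apply: leq_ones => x y _ _ /andP[Wxy nE]; rewrite Wxy /T /L /=.
  have [Exy /=|//] := boolP (E x y); have [Fxy /=|//] := boolP (F x y).
  apply: contra nE => /asboolP[y' yy /andP[Exy' /asboolP[x' xx Ex'y']]].
  rewrite /= Wxy; apply/asboolP; exists x', y'; split=> //.
  exact: stair_end_sub Exy'.
apply: leq_trans sub _; apply: leq_trans (ones_orW _ _ _ _) _.
have -> : 2 * m.+1 * s = 2 * m * s + (s * 1 + s * 1) by lia.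
apply: leq_add IHm _; apply: leq_trans (ones_orW _ _ _ _) _; apply: leq_add.
  apply: ones_col => y; apply: (@sum_window (T ^~ y)) => x x' /andP[Ex nF] /andP[Ex' nF'].
  rewrite addn1 ltnS leqNgt; apply: contra nF' => xx.
  by rewrite /F Ex'; apply/asboolP; exists x.
apply: ones_row => x; apply: (@sum_window (L x)) => y y' /andP[Fy _] /andP[_].
rewrite addn1 ltnS leqNgt; apply: contra => yy.
by apply/asboolP; exists y.
Qed.

Lemma staircase_exists W m s : 2 * m * s < ones s s W ->
  exists x y, staircase W m x y.
Proof.
move=> many; apply: contrapT => none; move: many; apply/negP; rewrite -leqNgt.
apply: leq_trans (ones_not_stair_end W m s); apply: leq_ones => x y _ _ ->.
by apply/negP => /stair_endP st; apply: none; exists x, y.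
Qed.

(* Listed as [b 0, a 0, b 1, a 1, ...], these rows and columns form a cycle of
   length [2 * k] (a single edge when [k = 1]). *)
Definition cycle_in (M : rel nat) k x y x' y' := exists a b : nat -> nat,
  [/\ increasing k a /\ increasing k b,
      forall i, i < k -> (x <= a i < x') && (y <= b i < y'),
      forall i, i < k -> M (a i) (b i),
      forall i, i.+1 < k -> M (a i) (b i.+1)
    & M (a k.-1) (b 0)].

(* The cells [(i, j)] forming a 4-cycle with bottom left corner [(r, c)]. *)
Definition corner (s : nat) (M : rel nat) r c : rel nat := fun i j =>
  [&& (i < r) && (c < j), (r < s) && (j < s), M i c && M r j & M i j && M r c].

(** The corner cells are numerous enough to contain a staircase on [k.-1] rows and columns; row [r]
    below it and column [c] to its left close it into a cycle. For [k = 1] the one at [(r, c)]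
    suffices. *)
Lemma cycle_in_of_corner M s k r c : 0 < k ->
  2 * k * s < ones s s (corner s M r c) -> cycle_in M k 0 0 s s.
Proof.
move=> k_gt0 many; case: k k_gt0 many => [//|[_|k _]] many.
  have [x [y [a [b [_ _ /(_ 0 isT) W0 _]]]]] : exists x y, staircase (corner s M r c) 0 x y.
    by apply: (@staircase_exists _ 0 s); apply: leq_ltn_trans many; lia.
  have /and4P[/andP[_ cb] /andP[rs bs] _ /andP[_ Mrc]] := W0.
  exists (fun=> r), (fun=> c); split=> //.
    by split=> i j; lia.
  by move=> i _; rewrite rs (ltn_trans cb bs).
have [x [y [a [b [[inca incb] _ W0 W1]]]]] : exists x y, staircase (corner s M r c) k x y.
  apply: (@staircase_exists _ _ s); apply: leq_ltn_trans many.
  by rewrite leq_mul2r; apply/orP; right; lia.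
have {}W0 i : i <= k -> [/\ a i < r, c < b i, r < s & b i < s] /\
    [/\ M (a i) c, M r (b i), M (a i) (b i) & M r c].
  by move=> /W0 /and4P[/andP[? ?] /andP[? ?] /andP[? ?] /andP[? ?]].
have {}W1 i : i < k -> M (a i.+1) (b i) by move=> /W1 /and4P[_ _ _ /andP[]].
(* Putting [c] first shifts the staircase columns by one: the cells [(a i, b i)] become the
   off-diagonal edges of the cycle, and [(a i.+1, b i)] the diagonal ones. *)
exists (fun i => if i <= k then a i else r), (fun i => if i is i'.+1 then b i' else c).
split.
- split=> i j ij jk.
    have ik : i <= k by lia.
    rewrite ik; case: (leqP j k) => jk'; first by apply: inca.
    by have [[]] := W0 i ik.
  case: j ij jk => [//|j] ij jk; case: i ij => [|i] ij; last by apply: incb; lia.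
  by have [[]] := W0 j jk.
- move=> i ik; apply/andP; split.
    case: (leqP i k) => ik'; first by have [[]] := W0 i ik'; lia.
    by have [[]] := W0 0 isT.
  case: i ik => [_|i ik]; first by have [[]] := W0 0 isT; lia.
  by have [[]] := W0 i ik.
- case=> [_|i ik]; first by have [_ []] := W0 0 isT.
  case: (leqP i.+1 k) => ik'; first by apply: W1; lia.
  by have [_ []] := W0 i ik.
- move=> i ik; have ik' : i <= k by lia.
  by rewrite ik'; have [_ []] := W0 i ik'.
- by rewrite /= ltnn; have [_ []] := W0 0 isT.
Qed.

(** * Counting 4-cycles with the Cauchy-Schwarz inequality *)

Lemma sum_sqr_le n (F : nat -> nat) :
  (\sum_(i < n) F i) ^ 2 <= n * \sum_(i < n) F i ^ 2.
Proof.
rewrite -(leq_pmul2l (isT : 0 < 2)) -mulnn big_distrlr /= big_distrr /=.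
have -> : 2 * (n * \sum_(i < n) F i ^ 2) =
    \sum_(i < n) \sum_(j < n) (F i ^ 2 + F j ^ 2).
  under [RHS]eq_bigr => i _ do rewrite big_split /= sum_nat_const card_ord.
  by rewrite big_split /= sum_nat_const card_ord -big_distrr /= mul2n addnn.
apply: leq_sum => i _; rewrite big_distrr /=; apply: leq_sum => j _.
exact: nat_Cauchy.
Qed.

Lemma sum_sym_le s (F : nat -> nat -> nat) : (forall i j, F i j = F j i) ->
  \sum_(i < s) \sum_(j < s) F i j <=
  2 * (\sum_(i < s) \sum_(j < s) (i < j) * F i j) + \sum_(i < s) F i i.
Proof.
move=> Fsym; pose A := \sum_(i < s) \sum_(j < s) (i < j) * F i j.
have A' : A = \sum_(i < s) \sum_(j < s) (j < i) * F i j.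
  rewrite exchange_big /=; apply: eq_bigr => i _; apply: eq_bigr => j _.
  by rewrite Fsym.
rewrite -/A mul2n -addnn {2}A' /A -!big_split /=; apply: leq_sum => i _.
rewrite -big_split /= [X in _ + X](_ : _ = \sum_(j < s) (i == j) * F i j).
  rewrite -big_split; apply: leq_sum => j _ /=.
  by rewrite -val_eqE /=; case: ltngtP; rewrite ?mul1n ?mul0n ?addn0.
rewrite (bigD1 i) //= eqxx mul1n big1 ?addn0 // => j /negPf.
by rewrite eq_sym => ->.
Qed.

Section C4.
Variables (M : rel nat) (s : nat).

Let codeg i r := \sum_(c < s) M i c * M r c.
Let g i r c j := (M i c * M r c) * (M i j * M r j).

(** Cauchy-Schwarz twice: over columns it bounds the square of the number of ones by the sum of
    codegrees of rows, and over pairs of rows it passes to squared codegrees. *)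
Lemma ones_pow4_le : ones s s M ^ 4 <= s ^ 4 * (\sum_(i < s) \sum_(r < s) codeg i r ^ 2).
Proof.
have le1 : ones s s M ^ 2 <= s * \sum_(i < s) \sum_(r < s) codeg i r.
  rewrite ones_transpose.
  apply: leq_trans (sum_sqr_le s (fun c => \sum_(i < s) M i c)) _.
  rewrite leq_mul2l; apply/orP; right; rewrite /codeg.
  under eq_bigr => c _ do rewrite -mulnn big_distrlr /=.
  rewrite exchange_big /=; apply: leq_sum => i _.
  by rewrite exchange_big.
have le2 : (\sum_(i < s) \sum_(r < s) codeg i r) ^ 2 <=
    s ^ 2 * \sum_(i < s) \sum_(r < s) codeg i r ^ 2.
  apply: leq_trans (sum_sqr_le s (fun i => \sum_(r < s) codeg i r)) _.
  rewrite -mulnn -mulnA leq_mul2l; apply/orP; right.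
  rewrite big_distrr /=; apply: leq_sum => i _.
  exact: (sum_sqr_le s (codeg i)).
rewrite (expnM _ 2 2) (expnM _ 2 2); apply: (@leq_trans ((s * \sum_(i < s) \sum_(r < s) codeg i r) ^ 2)).
  by rewrite leq_sqr.
by rewrite expnMn -[(s ^ 2) ^ 2]mulnn -mulnA leq_mul2l le2 orbT.
Qed.

(** The left side counts 4-cycles on rows [i], [r] and columns [c], [j], degenerate ones included.
    Imposing [i < r] and [c < j] costs a factor 4 by symmetry, and makes [(r, c)] the bottom left
    corner; the cases [i = r] and [c = j] give the cubic term. *)
Lemma sum_codeg_sqr_le :
  \sum_(i < s) \sum_(r < s) codeg i r ^ 2 <=
  4 * (\sum_(r < s) \sum_(c < s) ones s s (corner s M r c)) + 3 * s ^ 3.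
Proof.
have g_le1 i r c j : g i r c j <= 1 by rewrite /g; do 4!case: (M _ _).
have codegE i r : codeg i r ^ 2 = \sum_(c < s) \sum_(j < s) g i r c j.
  by rewrite -mulnn big_distrlr.
have sum_le1 (F : nat -> nat) : (forall i, F i <= 1) -> \sum_(i < s) F i <= s.
  by move=> F1; rewrite -[s in _ <= s]card_ord -sum1_card; apply: leq_sum.
have sum_le t (F : nat -> nat) : (forall i, F i <= t) -> \sum_(i < s) F i <= s * t.
  by move=> Ft; rewrite -[s in _ <= s * _]card_ord -sum_nat_const; apply: leq_sum.
have step1 : \sum_(i < s) \sum_(r < s) codeg i r ^ 2 <=
    2 * (\sum_(i < s) \sum_(r < s) (i < r) * codeg i r ^ 2) + s ^ 3.
  apply: leq_trans (@sum_sym_le s (fun i r => codeg i r ^ 2) _) _.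
    by move=> i r; congr (_ ^ _); apply: eq_bigr => c _; rewrite mulnC.
  rewrite leq_add2l expnS; apply: (@sum_le _ (fun i => codeg i i ^ 2)) => i.
  by rewrite leq_sqr; apply: (@sum_le1 (fun c => M i c * M i c)) => c; case: (M i c).
have step2 i r : codeg i r ^ 2 <=
    2 * (\sum_(c < s) \sum_(j < s) (c < j) * g i r c j) + s.
  rewrite codegE; apply: leq_trans (@sum_sym_le s (g i r) _) _.
    by move=> c j; rewrite /g mulnC.
  by rewrite leq_add2l; apply: (@sum_le1 (fun c => g i r c c)).
have step3 : \sum_(i < s) \sum_(r < s) (i < r) * codeg i r ^ 2 <=
    2 * (\sum_(i < s) \sum_(r < s) \sum_(c < s) \sum_(j < s) (i < r) * ((c < j) * g i r c j))
    + s ^ 3.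
  apply: (@leq_trans (\sum_(i < s) \sum_(r < s)
     (2 * (\sum_(c < s) \sum_(j < s) (i < r) * ((c < j) * g i r c j)) + s))).
    apply: leq_sum => i _; apply: leq_sum => r _; case: (i < r) => /=.
      rewrite mul1n; apply: leq_trans (step2 i r) _; rewrite leq_add2r leq_mul2l /=.
      by apply: leq_sum => c _; apply: leq_sum => j _; rewrite mul1n.
    by rewrite mul0n.
  under eq_bigr => i _ do rewrite big_split /= -big_distrr /= sum_nat_const card_ord.
  by rewrite big_split /= -big_distrr /= sum_nat_const card_ord !expnS expn0 muln1.
have step4 : \sum_(i < s) \sum_(r < s) \sum_(c < s) \sum_(j < s) (i < r) * ((c < j) * g i r c j) <=
    \sum_(r < s) \sum_(c < s) ones s s (corner s M r c).
  rewrite exchange_big /=; apply: leq_sum => r _; rewrite exchange_big /=.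
  apply: leq_sum => c _; apply: leq_sum => i _; apply: leq_sum => j _.
  rewrite /corner /g !ltn_ord.
  by case: (i < r); case: (c < j); do 4!case: (M _ _).
lia.
Qed.
End C4.

(** Without the cycle every corner has at most [2 * k * s] cells, so the codegree bounds give $s^4
    \le D^4(8k+3)s^3$. This contradicts $s = 17D^4k$, because $8k+3 < 17k$. *)
Lemma cycle_in_dense M D k s : 0 < D -> 0 < k -> s = 17 * D ^ 4 * k ->
  s * s <= D * ones s s M -> cycle_in M k 0 0 s s.
Proof.
move=> D_gt0 k_gt0 sE dense; apply: contrapT => nocyc.
have few r c : ones s s (corner s M r c) <= 2 * k * s.
  by rewrite leqNgt; apply/negP => /(cycle_in_of_corner k_gt0).
have Q : \sum_(r < s) \sum_(c < s) ones s s (corner s M r c) <= s * (s * (2 * k * s)).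
  rewrite -[X in X * _]card_ord -sum_nat_const; apply: leq_sum => r _.
  by rewrite -[X in X * _]card_ord -sum_nat_const; apply: leq_sum => c _.
have := sum_codeg_sqr_le M s; have := ones_pow4_le M s.
move: (\sum_(i < s) _) => S le4 leS.
have D4 : 0 < D ^ 4 by rewrite expn_gt0 D_gt0.
have s_gt0 : 0 < s by rewrite sE muln_gt0 k_gt0 muln_gt0 D4.
have le5 : s ^ 4 <= D ^ 4 * S.
  rewrite -(@leq_pmul2l (s ^ 4)) ?expn_gt0 ?s_gt0 // mulnCA.
  apply: (@leq_trans (D ^ 4 * ones s s M ^ 4)); last by rewrite leq_mul2l le4 orbT.
  by rewrite -!expnMn leq_exp2r.
have : s ^ 4 <= D ^ 4 * (8 * k + 3) * s ^ 3.
  apply: leq_trans le5 _; rewrite -mulnA leq_mul2l; apply/orP; right.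
  apply: leq_trans leS _; rewrite mulnDl leq_add2r.
  apply: leq_trans (leq_mul (leqnn 4) Q) _.
  by rewrite leq_eqVlt; apply/orP; left; apply/eqP; rewrite !expnS expn0; lia.
rewrite [s ^ 4]expnS leq_pmul2r ?expn_gt0 ?s_gt0 // leqNgt => /negP; apply.
rewrite sE -mulnA [ltnRHS]mulnCA ltn_pmul2l; [lia|exact: D4].
Qed.

(** * Direct sums of cycles *)

(* The head of the list is the last (bottom right) summand. *)
Fixpoint cycle_chain (M : rel nat) (ks : seq nat) (x y : nat) : Prop :=
  if ks is k :: ks' then
    exists x' y', cycle_chain M ks' x' y' /\ cycle_in M k x' y' x y
  else True.

Lemma cycle_in_widen M k x0 y0 x y x' y' : x <= x' -> y <= y' ->
  cycle_in M k x0 y0 x y -> cycle_in M k x0 y0 x' y'.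
Proof.
move=> xx yy [a [b [inc rng M0 M1 M2]]]; exists a, b; split=> // i /rng.
by move=> /andP[/andP[-> h1] /andP[-> h2]]; rewrite (leq_trans h1) ?(leq_trans h2).
Qed.

Lemma cycle_in_shift M k x y s t : cycle_in (shift M x y) k 0 0 s t ->
  cycle_in M k x y (x + s) (y + t).
Proof.
move=> [a [b [[inca incb] rng M0 M1 M2]]].
exists (fun i => x + a i), (fun i => y + b i); split=> //.
- by split=> i j ij jk; rewrite ltn_add2l; [apply: inca|apply: incb].
- by move=> i /rng /andP[/andP[_ h1] /andP[_ h2]]; rewrite !leq_addr !ltn_add2l h1.
Qed.

Lemma cycle_chain_widen M ks x y x' y' : x <= x' -> y <= y' ->
  cycle_chain M ks x y -> cycle_chain M ks x' y'.
Proof.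
case: ks => [//|k ks] xx yy [x0 [y0 [ch cy]]].
by exists x0, y0; split=> //; apply: cycle_in_widen cy.
Qed.

(** The removed cycle has at least one row and one column, which forces the shorter chain to end
    before [(x, y)]. *)
Lemma cycle_chain_behead M k ks x y : 0 < k ->
  cycle_chain M (k :: ks) x y -> cycle_chain M ks x y.
Proof.
move=> k_gt0 [x0 [y0 [ch [a [b [_ /(_ 0 k_gt0) rng _ _ _]]]]]].
by apply: cycle_chain_widen ch; lia.
Qed.

(** Induction on the summands. Adding [k] enlarges the down-closed set [A] to [B], and [ones_layer]
    applied to the difference, with blocks large enough for a cycle of parameter [k], contributes
    the error term for [k]. *)
Lemma ones_no_cycle_chain M D N ks : 0 < D -> all (leq 1) ks ->
  let A x y := ~~ `[< cycle_chain M ks x y >] in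
  D * ones N N (fun x y => M x y && A x y) <=
  ones N N A + D * (4 * N * (17 * D ^ 4 * sumn ks)).
Proof.
move=> D_gt0; elim: ks => [|k ks IHks] /=.
  move=> _; rewrite [ones _ _ _](_ : _ = 0) ?muln0 //.
  rewrite /ones big1 // => x _; rewrite big1 // => y _.
  by case: asboolP => // _; rewrite andbF.
move=> /andP[k_gt0 /IHks]; set s := 17 * D ^ 4 * k.
pose A x y := ~~ `[< cycle_chain M ks x y >].
pose B x y := ~~ `[< cycle_chain M (k :: ks) x y >].
rewrite /= -/(cycle_chain M (k :: ks) _ _) => IH.
have dA : downclosed A.
  move=> x y x' y' xx yy; apply: contra => /asboolP ch.
  by apply/asboolP; apply: cycle_chain_widen ch.
have dB : downclosed B.
  move=> x y x' y' xx yy; apply: contra => /asboolP ch.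
  by apply/asboolP; apply: cycle_chain_widen ch.
have AB x y : A x y -> B x y.
  apply: contra => /asboolP ch; apply/asboolP.
  exact: cycle_chain_behead ch.
have s_gt0 : 0 < s by rewrite /s muln_gt0 k_gt0 muln_gt0 expn_gt0 D_gt0.
(* Outside [A] the chain [ks] already fits before [(x, y)], and a dense block starting there
   supplies the next cycle. *)
have dense x y : ~~ A x y -> s * s <= D * ones s s (shift M x y) ->
    ~~ B (x + s) (y + s).
  move=> /negPn /asboolP ch dns; rewrite negbK; apply/asboolP.
  exists x, y; split=> //; apply: cycle_in_shift.
  exact: cycle_in_dense dns.
have := ones_layer N s_gt0 dA dB dense.
have -> : D * (4 * N * (17 * D ^ 4 * (k + sumn ks))) =
    D * (4 * N * s) + D * (4 * N * (17 * D ^ 4 * sumn ks)).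
  by rewrite -mulnDr -mulnDr /s -mulnDr.
have splitB (P : rel nat) : ones N N (fun x y => P x y && B x y) =
    ones N N (fun x y => [&& P x y, B x y & ~~ A x y]) + ones N N (fun x y => P x y && A x y).
  rewrite /ones -big_split; apply: eq_bigr => x _; rewrite -big_split.
  apply: eq_bigr => y _; have := AB x y.
  by case: (A x y); case: (B x y); case: (P x y) => // /(_ isT).
move=> layer; rewrite -/(B _ _) in IH *.
have -> : ones N N (fun x y => M x y && ~~ `[< exists x' y', cycle_chain M ks x' y' /\
    cycle_in M k x' y' x y >]) = ones N N (fun x y => M x y && B x y) by [].
have -> : ones N N (fun x y => ~~ `[< exists x' y', cycle_chain M ks x' y' /\
    cycle_in M k x' y' x y >]) = ones N N (fun x y => true && B x y) by [].
rewrite !splitB mulnDr; apply: leq_trans (leq_add layer IH) _.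
by rewrite addnACA.
Qed.

Lemma cycle_chain_dense D : 0 < D -> exists c, forall M N ks,
  all (leq 1) ks -> c * sumn ks < N -> N * N <= D * ones N N M ->
  cycle_chain M ks N N.
Proof.
(* The layer bound is used with [2 * D]: if no chain exists, it reads $2De \le N^2 + 8DNc'\sigma$,
   where $e$ is the number of ones, $c' = 17(2D)^4$ and $\sigma$ is the sum of [ks]. With $N^2 \le
   De$ this yields $N \le 8Dc'\sigma$. *)
move=> D_gt0; exists (8 * D * (17 * (2 * D) ^ 4)) => M N ks ks_gt0.
rewrite -mulnA => N_big dense; apply: contrapT => nochain.
have DD_gt0 : 0 < 2 * D by rewrite muln_gt0.
have /= := @ones_no_cycle_chain M (2 * D) N ks DD_gt0 ks_gt0.
have allA x y : x < N -> y < N -> ~~ `[< cycle_chain M ks x y >].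
  move=> xN yN; apply/asboolP => ch; apply: nochain.
  exact: cycle_chain_widen (ltnW xN) (ltnW yN) ch.
rewrite (ones_all allA).
have -> : ones N N (fun x y => M x y && ~~ `[< cycle_chain M ks x y >]) = ones N N M.
  by apply: eq_bigr => x _; apply: eq_bigr => y _; rewrite allA ?andbT.
move: (17 * _ * _) N_big => c N_big; apply/negP; rewrite -ltnNge.
have : N * (8 * D * c) < N * N by rewrite ltn_pmul2l //; lia.
by move: dense; lia.
Qed.

(** * Cutting a dense upper triangular matrix into initial rows and final columns *)

Lemma sum_interval N x y : y < N -> \sum_(t < N) ((x < t) && (t <= y)) = y - x.
Proof.
move=> yN; rewrite -(big_mkord predT (fun t => (x < t) && (t <= y) : nat)).
have [xy|yx] := leqP x y; last first.
  by rewrite big1 => [|t _]; [lia|case: ltnP => // ?; case: leqP => //; lia].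
rewrite (big_cat_nat (n := x.+1)) //=; last by lia.
rewrite (big_cat_nat (n := y.+1) (m := x.+1)) //=.
rewrite big_nat big1 => [|t]; last by case: ltnP => // ?; lia.
rewrite [X in _ + (_ + X)]big_nat [X in _ + (_ + X)]big1 => [|t /andP[yt _]]; last by lia.
rewrite addn0 add0n (eq_big_nat _ _ (F2 := fun=> 1)); last by move=> t; lia.
by rewrite sum_nat_const_nat muln1 subSS.
Qed.

(* A one at distance at least [L] from the diagonal lies in the rectangle
   [x < t <= y] for at least [L] values of [t]. *)
Lemma dense_split (up : rel nat) E L N : 0 < N -> N = 2 * E * L ->
  (forall x y, up x y -> x < y) -> N * N <= E * ones N N up ->
  exists t, N * N <= 4 * E ^ 2 * ones N N (fun x y => [&& up x y, x < t & t <= y]).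
Proof.
move=> N_gt0 NE up_lt dense.
pose cross t x y := [&& up x y, x < t & t <= y].
pose short x y := up x y && (y < x + L).
pose long x y := up x y && (x + L <= y).
have shortN : ones N N short <= N * L.
  apply: ones_row => x; apply: (@sum_window (short x)) => y y'.
  by move=> /andP[/up_lt ? ?] /andP[/up_lt ? ?]; lia.
have split_up : ones N N up <= ones N N short + ones N N long.
  apply: leq_trans (ones_orW _ _ _ _); apply: leq_ones => x y _ _ upxy.
  by rewrite /short /long upxy /=; case: ltnP.
have longN : N * N <= 2 * E * ones N N long.
  have h1 := leq_mul (leqnn E) split_up; rewrite mulnDr in h1.
  have h2 := leq_mul (leqnn E) shortN.
  have h3 : 2 * (E * (N * L)) = N * N by rewrite [in RHS]NE; lia.
  rewrite -mulnA; lia.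
have sum_cross : L * ones N N long <= \sum_(t < N) ones N N (cross t).
  rewrite /ones [leqRHS]exchange_big big_distrr /=; apply: leq_sum => x _.
  rewrite [leqRHS]exchange_big big_distrr /=; apply: leq_sum => y _.
  rewrite /long /cross; case: (up x y); last by rewrite /= muln0.
  rewrite (eq_bigr (fun t : 'I_N => (x < t) && (t <= y) : nat)) //.
  by rewrite sum_interval // /=; case: leqP => ?; rewrite ?muln0 ?muln1 //; lia.
(* Averaging over the [N] cuts: at least $N^2/(2E)$ long ones, each crossing at least $L = N/(2E)$
   cuts, give a mean of at least $N^2/(4E^2)$. *)
apply: contrapT => none.
have few t : 4 * E ^ 2 * ones N N (cross t) < N * N.
  by rewrite ltnNge; apply/negP => le; apply: none; exists t.
have : 4 * E ^ 2 * \sum_(t < N) ones N N (cross t) < N * (N * N).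
  rewrite big_distrr /= -[X in _ < X * _]card_ord -sum_nat_const.
  case: N N_gt0 few {NE dense shortN split_up longN sum_cross none} => // n _ few.
  rewrite !big_ord_recl -addSn; apply: leq_add; first exact: few.
  by apply: leq_sum => t _; apply: ltnW; apply: few.
apply/negP; rewrite -leqNgt.
apply: (@leq_trans ((2 * E * L) * (2 * E * ones N N long))).
  by rewrite -NE leq_mul2l longN orbT.
have -> : (2 * E * L) * (2 * E * ones N N long) = 4 * E ^ 2 * (L * ones N N long).
  by rewrite -mulnn; lia.
by rewrite leq_mul2l sum_cross orbT.
Qed.

(** * Graphs of maximum degree two *)

(* Positions on a path with [q] vertices whose ends may be joined if [q] is even. *)
Definition link (q i j : nat) : bool :=
  [|| j == i.+1, i == j.+1, [&& ~~ odd q, i == 0 & j == q.-1]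
    | [&& ~~ odd q, j == 0 & i == q.-1]].

Lemma link_sym q i j : link q i j = link q j i.
Proof. by rewrite /link orbCA; do 2!congr (_ || _); rewrite orbC. Qed.

(** Here [b] is the colour of the first vertex of a path with alternating colours. Two distinct ends
    of opposite colours force [q] to be even, which is when [link] joins the ends. *)
Lemma link_ends (b : bool) q i j : i < q -> j < q -> i != j ->
  ~~ ((0 < i) && (i.+1 < q)) -> ~~ ((0 < j) && (j.+1 < q)) ->
  b (+) odd i != b (+) odd j -> link q i j.
Proof.
move=> iq jq ij i_end j_end par.
have [[iE jE]|[iE jE]] : (i = 0 /\ j = q.-1) \/ (i = q.-1 /\ j = 0) by lia.
all: have even_q : ~~ odd q by move: par; rewrite iE jE; case: b => /=; lia.
all: by rewrite /link even_q iE jE !eqxx ?orbT.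
Qed.

(** Edges must be links, but links may be non-edges; paths and even cycles are thus treated
    alike. *)
Definition link_decomposition (G : sgraph) (U : {set G}) (cs : seq (seq G)) :=
  [/\ all (fun c => 0 < size c) cs, uniq (flatten cs), flatten cs =i U
    & forall x y, x \in U -> x -- y -> exists c,
      [/\ c \in cs, x \in c, y \in c & link (size c) (index x c) (index y c)]].

Section Decomposition.
Variables (G : sgraph) (A : {set G}).
Hypothesis A_bip : forall x y : G, x -- y -> (x \in A) != (y \in A).
Hypothesis deg2 : max_degree G <= 2.

Lemma neighbour_or (a u v w : G) :
  a -- u -> a -- v -> u != v -> a -- w -> (w == u) || (w == v).
Proof.
move=> au av uv aw; apply: contraT; rewrite negb_or => /andP[wu wv].
have : #|[set w; u; v]| <= degree a.
  apply: subset_leq_card; apply/subsetP => z; rewrite !inE.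
  by move=> /orP[/orP[]|] /eqP ->.
rewrite leqNgt (leq_ltn_trans (leq_trans (leq_bigmax a) deg2)) //.
by rewrite -setUA cardsU1 cards2 uv !inE negb_or wu wv.
Qed.

Definition path_in (U : {set G}) (c : seq G) :=
  [&& uniq c, sorted (@sedge G) c & all (mem U) c].

Lemma longest_path (U : {set G}) : U != set0 -> exists c,
  [/\ 0 < size c, path_in U c & forall c', path_in U c' -> size c' <= size c].
Proof.
move=> /set0Pn[x0 x0U]; pose P n := [exists c : n.-tuple G, path_in U c].
have exP : exists n, P n.
  by exists 1; apply/existsP; exists [tuple x0]; rewrite /path_in /= x0U.
have bound n : P n -> n <= #|G|.
  move=> /existsP[c /and3P[c_uniq _ _]].
  by rewrite -(size_tuple c) -(card_uniqP c_uniq) max_card.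
case: (ex_maxnP exP bound) => n /existsP[c c_path] c_max.
have mx c' : path_in U c' -> size c' <= n.
  by move=> c'_path; apply: c_max; apply/existsP; exists (in_tuple c').
exists c; split=> //; last by move=> c' /mx; rewrite size_tuple.
by rewrite size_tuple; apply: (mx [:: x0]); rewrite /path_in /= x0U.
Qed.

(** An interior vertex already has its two neighbours next to it on the path. A neighbour of an end
    lies on the path by maximality; it is either interior, and the first case applies with the roles
    exchanged, or the other end, and the bipartition gives the right parity. *)
Lemma longest_path_link (U : {set G}) c :
  (forall x y, x \in U -> x -- y -> y \in U) -> path_in U c ->
  (forall c', path_in U c' -> size c' <= size c) ->
  forall x y, x \in c -> x -- y ->
    y \in c /\ link (size c) (index x c) (index y c).
Proof.
move=> U_closed /and3P[c_uniq c_sorted cU] c_max x y xc xy.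
pose q := size c; pose z i := nth x c i.
have zE u : u \in c -> z (index u c) = u by move=> uc; apply: nth_index.
have zedge i : i.+1 < q -> z i -- z i.+1.
  by move=> iq; move/(sortedP x): c_sorted; apply.
have zedge' i : i.+1 < q -> z i.+1 -- z i by rewrite sedge_sym; apply: zedge.
have zc i : i < q -> z i \in c by apply: mem_nth.
have indz i : i < q -> index (z i) c = i by move=> iq; apply: index_uniq.
have interior u v : u \in c -> u -- v -> 0 < index u c -> (index u c).+1 < q ->
    v \in c /\ link q (index u c) (index v c).
  move=> uc; rewrite -{1}(zE u uc); case: (index u c) => // i iv _ iq.
  have : (v == z i) || (v == z i.+2).
    apply: neighbour_or iv; [apply: zedge'; lia|exact: zedge|].
    by rewrite /z nth_uniq -/q; lia.
  by case/orP => /eqP ->; rewrite zc ?indz ?/link ?eqxx ?orbT //; lia.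
have parity i : i < q -> (z i \in A) = (z 0 \in A) (+) odd i.
  elim: i => [|i IHi] iq; first by rewrite addbF.
  have := A_bip (zedge i iq); rewrite (IHi (ltnW iq)) /=.
  by case: (z 0 \in A); case: (odd i); case: (z i.+1 \in A).
have xU : x \in U by move/allP: cU; apply.
have yU : y \in U by apply: U_closed xy.
have iq : index x c < q by rewrite index_mem.
have xz := zE x xc.
have [x_in|x_end] := boolP ((0 < index x c) && ((index x c).+1 < q)).
  by have /andP[? ?] := x_in; apply: interior.
(* Otherwise [y] would prolong the path at the end [x]. *)
have yc : y \in c.
  apply: contraT => yc.
  have [x_first|x_last] : index x c = 0 \/ index x c = q.-1 by lia.
    have : size (y :: c) <= size c; last by rewrite ltnn.
    apply: c_max; apply/and3P; split; rewrite ?cons_uniq ?yc /= ?yU //.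
    rewrite -[path _ _ _]/(sorted (@sedge G) (y :: c)).
    apply/(sortedP x) => -[|i] /= ic; last exact: zedge.
    by rewrite -/(z 0) -x_first xz sedge_sym.
  have : size (rcons c y) <= size c; last by rewrite size_rcons ltnn.
  apply: c_max; rewrite /path_in rcons_uniq all_rcons yc c_uniq cU /= yU !andbT.
  have lastc : last x c = x by rewrite -nth_last -/(z _) -x_last.
  case: (c) xc lastc c_sorted => //= a c' _ lastc srt.
  by rewrite rcons_path srt lastc.
split=> //; have jq : index y c < q by rewrite index_mem.
have yz := zE y yc.
have [y_in|y_end] := boolP ((0 < index y c) && ((index y c).+1 < q)).
  have /andP[? ?] := y_in; rewrite link_sym; apply: (interior y x _ _ _ _).2 => //.
  by rewrite sedge_sym.
have ij : index x c != index y c.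
  apply/eqP => ij; move: xy; rewrite -yz -ij xz.
  by rewrite sedge_irr.
have := A_bip xy; rewrite -{1}xz -{1}yz (parity _ iq) (parity _ jq).
exact: link_ends.
Qed.

(** Strong induction on the size of [U]: the vertices of a longest path are closed under adjacency,
    so removing them leaves a closed set. *)
Lemma link_decomposition_exists (U : {set G}) :
  (forall x y, x \in U -> x -- y -> y \in U) ->
  exists cs, link_decomposition U cs.
Proof.
have [n leUn] := ubnP #|U|; elim: n U leUn => // n IHn U leUn U_closed.
have [->|U_neq0] := eqVneq U set0.
  by exists [::]; split=> //= [x|x y]; rewrite inE.
have [c [c_gt0 c_path c_max]] := longest_path U_neq0.
have c_link := longest_path_link U_closed c_path c_max.
have /and3P[c_uniq _ /allP cU] := c_path.
pose V := U :\: [set x in c].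
have V_closed x y : x \in V -> x -- y -> y \in V.
  rewrite !inE => /andP[xc xU] xy; rewrite (U_closed x y) // andbT.
  by apply: contra xc => yc; apply: (c_link y x yc _).1; rewrite sedge_sym.
have leVn : #|V| < n.
  rewrite -ltnS; apply: leq_trans leUn; rewrite ltnS; apply: proper_card.
  apply/properP; split; first exact: subsetDl.
  case: c c_gt0 cU @V {c_path c_max c_link c_uniq V_closed} => // a c _ cU.
  by exists a; rewrite ?inE ?eqxx //; apply: cU; rewrite inE eqxx.
have [cs [cs_gt0 cs_uniq csV cs_link]] := IHn V leVn V_closed.
exists (c :: cs); split=> [||x|x y xU xy].
- by rewrite /= c_gt0.
- rewrite /= cat_uniq c_uniq cs_uniq andbT /=; apply/hasPn => x.
  by rewrite csV !inE => /andP[].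
- rewrite /= mem_cat csV !inE; case: (boolP (x \in c)) => //= xc.
  exact/esym/cU.
have [xc|xc] := boolP (x \in c).
  have [yc lk] := c_link x y xc xy.
  by exists c; rewrite mem_head.
have [|c' [c'cs xc' yc' lk]] := cs_link x y _ xy; first by rewrite !inE xc.
by exists c'; rewrite inE c'cs orbT.
Qed.
End Decomposition.

(** * Embedding *)

(* Vertices at odd positions of their component are rows; as in [cycle_chain], the
   head of [cs] comes last in the ordering. *)
Fixpoint is_row (T : eqType) (cs : seq (seq T)) (v : T) : bool :=
  if cs is c :: cs' then
    if v \in c then odd (index v c) else is_row cs' v
  else false.

Fixpoint rank (T : eqType) (cs : seq (seq T)) (v : T) : nat :=
  if cs is c :: cs' then
    if v \in c then size (flatten cs') + index v c else rank cs' v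
  else 0.

Lemma rank_lt (T : eqType) (cs : seq (seq T)) (v : T) :
  v \in flatten cs -> rank cs v < size (flatten cs).
Proof.
elim: cs => //= c cs IHcs; rewrite mem_cat size_cat.
case: ifP => [vc _|_ /IHcs]; last by lia.
by rewrite addnC ltn_add2r index_mem.
Qed.

Lemma rank_inj (T : eqType) (cs : seq (seq T)) :
  {in flatten cs &, injective (rank cs)}.
Proof.
elim: cs => //= c cs IHcs u v; rewrite !mem_cat.
case: ifP => [uc _|_ /= ucs]; case: ifP => [vc _|_ /= vcs].
- by move/addnI => /(congr1 (nth u c)); rewrite !nth_index.
- by have := rank_lt vcs; lia.
- by have := rank_lt ucs; lia.
- exact: IHcs.
Qed.

(** Ranks stay below [size (flatten cs)], so this offset places every column after every row. *)
Definition order_key (T : eqType) (cs : seq (seq T)) (v : T) : nat :=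
  (if is_row cs v then 0 else size (flatten cs)) + rank cs v.

Lemma order_key_inj (T : eqType) (cs : seq (seq T)) :
  {in flatten cs &, injective (order_key cs)}.
Proof.
move=> u v ucs vcs; have := rank_lt ucs; have := rank_lt vcs; rewrite /order_key.
case: ifP => _; case: ifP => _ ? ? eq_uv; try by exfalso; lia.
- exact: (rank_inj ucs vcs eq_uv).
- by move/addnI: eq_uv => eq_uv; exact: (rank_inj ucs vcs eq_uv).
Qed.

(** A piece with [q] vertices fits in a cycle with [uphalf q] rows and as many columns. The clause
    with [z] says that [f v] indexes a nonempty row or column, which later locates [f v] with
    respect to the cut. *)
Lemma cycle_chain_embedding (T : eqType) (cs : seq (seq T)) M X Y :
  all (fun c => 0 < size c) cs -> uniq (flatten cs) ->
  cycle_chain M [seq uphalf (size c) | c <- cs] X Y ->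
  exists f : T -> nat,
  [/\ forall v, v \in flatten cs -> f v < if is_row cs v then X else Y,
      forall u v, u \in flatten cs -> v \in flatten cs ->
        is_row cs u = is_row cs v -> rank cs u < rank cs v -> f u < f v,
      forall v, v \in flatten cs ->
        exists z, if is_row cs v then M (f v) z else M z (f v)
    & forall c u v, c \in cs -> u \in c -> v \in c ->
        link (size c) (index u c) (index v c) ->
        is_row cs u (+) is_row cs v /\ (is_row cs u -> M (f u) (f v))].
Proof.
elim: cs X Y => [|c cs IHcs] X Y /=; first by exists (fun=> 0); split.
rewrite cat_uniq => /andP[c_gt0 cs_gt0] /and3P[c_uniq /hasPn disj cs_uniq].
set k := uphalf _ => -[X' [Y' [/(IHcs _ _ cs_gt0 cs_uniq)]]] {IHcs}.
move=> [f [f_lt f_inc f_one f_link]] [a [b [[inca incb] rng M0 M1 M2]]].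
have half_lt v : v \in c -> (index v c)./2 < k.
  by rewrite -index_mem /k => lt; lia.
(* Index [2 * i] of the piece goes to column [b i] and index [2 * i + 1] to row [a i]; when the size
   is odd, the last row [a k.-1] is left out. *)
exists (fun v => if v \in c then if odd (index v c) then a (index v c)./2
                                 else b (index v c)./2 else f v).
split.
- move=> v; rewrite mem_cat; case: ifP => [vc _|_ /= vcs].
    by have /andP[/andP[_ ?] /andP[_ ?]] := rng _ (half_lt v vc); case: odd.
  have k_gt0 : 0 < k by rewrite /k; lia.
  by have := f_lt v vcs; have /andP[/andP[? ?] /andP[? ?]] := rng 0 k_gt0; case: is_row; lia.
- move=> u v; rewrite !mem_cat; case: ifP => [uc _|_ /= ucs];
    case: ifP => [vc _|_ /= vcs].
  + rewrite ltn_add2l => par lt.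
    by rewrite par; case: ifP par => oddv oddu; [apply: inca|apply: incb];
      rewrite ?half_lt //; lia.
  + by move=> _; have := rank_lt vcs; lia.
  + move=> par _; have := f_lt u ucs; rewrite par.
    have /andP[/andP[? _] /andP[? _]] := rng _ (half_lt v vc).
    by case: odd; lia.
  + exact: f_inc.
- move=> v; rewrite mem_cat; case: ifP => [vc _|_ /= vcs]; last exact: f_one.
  have := M0 _ (half_lt v vc); case: odd => M0v; first by exists (b (index v c)./2).
  by exists (a (index v c)./2).
move=> c' u v; rewrite inE => /orP[/eqP -> {c'}|c'cs] uc vc lk.
  rewrite uc vc; move: lk (uc) (vc); rewrite -!index_mem.
  have := half_lt u uc; have := half_lt v vc.
  move: (index u c) (index v c) => i j ik jk lk iq jq; split.
    by move: lk; rewrite /link; lia.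
  move=> oddi; rewrite oddi; have -> : odd j = false by move: lk; rewrite /link; lia.
  (* From an odd position [i], a link goes to the previous position, to the next one, or back from
     the last position to 0; these match the three kinds of edges in [cycle_in]. *)
  have [E|[E|[E E']]] : j./2 = i./2 \/ j./2 = i./2.+1 \/ (j./2 = 0 /\ i./2 = k.-1).
    by move: lk; rewrite /link /k; lia.
  - by rewrite E; apply: M0.
  - by rewrite E; apply: M1; rewrite -E.
  - by rewrite E E'.
have mem_cs w : w \in c' -> w \in flatten cs by move=> wc; apply/flattenP; exists c'.
rewrite (negPf (disj u (mem_cs u uc))) (negPf (disj v (mem_cs v vc))).
exact: f_link c'cs uc vc lk.
Qed.

(** * Vertex orders and ordered containment *)

Section KeyOrder.
Variables (G : sgraph) (key : G -> nat).
Hypothesis key_inj : injective key.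

Let key_le : rel G := fun u v => key u <= key v.

Lemma key_le_total : total key_le.
Proof. by move=> u v; apply: leq_total. Qed.

Lemma key_le_anti : antisymmetric key_le.
Proof. by move=> u v; rewrite -eqn_leq => /eqP /key_inj. Qed.

Lemma key_le_trans : transitive key_le.
Proof. by move=> v u w; apply: leq_trans. Qed.

Definition key_order : vertex_order G :=
  VertexOrder key_le_total key_le_anti key_le_trans.
End KeyOrder.

(** The subgraph has as edges only the images of edges of [G], since [H] may have further edges on
    these vertices and an isomorphism must reflect adjacency. Injectivity of [h] comes from
    antisymmetry of the order on [G]. *)
Lemma ocontained_of_embedding (G : sgraph) (o : vertex_order G) (H : ograph)
  (h : G -> H) : (forall u v, u -- v -> h u -- h v) ->
  (forall u v, oorder H (h u) (h v) = o u v) -> ocontained (OGraph o) H.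
Proof.
move=> h_edge h_ord.
have o_refl u : o u u by have := vle_total o u u; rewrite orbb.
have h_inj : injective h.
  by move=> u v huv; apply: (vle_anti (v := o)); rewrite -!h_ord huv h_ord o_refl.
pose e (x y : H) := [exists u, exists v, [&& x == h u, y == h v & u -- v]].
have e_sym : symmetric e.
  suff e_sym' x y : e x y -> e y x by move=> x y; apply/idP/idP; apply: e_sym'.
  move=> /existsP[u /existsP[v /and3P[xu yv uv]]].
  by apply/existsP; exists v; apply/existsP; exists u; rewrite xu yv sedge_sym.
have e_vertex x y : e x y -> x \in [set h u | u : G].
  by move=> /existsP[u /existsP[v /and3P[/eqP -> _ _]]]; apply: imset_f.
have e_edge : subrel e (@sedge H).
  move=> x y /existsP[u /existsP[v /and3P[/eqP -> /eqP -> uv]]].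
  exact: h_edge.
exists (Subgraph e_sym e_vertex e_edge).
have hS u : h u \in [set h u | u : G] by apply: imset_f.
exists (fun u => exist _ (h u) (hS u)); split.
- apply: inj_card_bij => [u v /(congr1 val) /h_inj //|].
  by rewrite card_sig -(card_imset predT h_inj) subset_leq_card //; apply/subsetP.
- move=> u v; apply/idP/idP => [/existsP[u' /existsP[v' /and3P[]]]|uv].
    by move=> /eqP /h_inj -> /eqP /h_inj ->.
  by apply/existsP; exists u; apply/existsP; exists v; rewrite !eqxx.
- exact: h_ord.
Qed.

Section Enumeration.
Variables (H : ograph) (x0 : H).

Definition ordered_vertices : seq H := sort (oorder H) (enum H).
Definition vertex_at i := nth x0 ordered_vertices i.

Lemma size_ordered_vertices : size ordered_vertices = #|H|.
Proof. by rewrite size_sort -cardE. Qed.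

Lemma vertex_at_le i j : i < #|H| -> j < #|H| ->
  oorder H (vertex_at i) (vertex_at j) = (i <= j).
Proof.
move=> iH jH; have srt : sorted (oorder H) ordered_vertices.
  by apply: sort_sorted; apply: vle_total.
have le_at a b : a <= b -> b < #|H| -> oorder H (vertex_at a) (vertex_at b).
  move=> ab bH; apply: sorted_leq_nth => //.
  - exact: vle_trans.
  - by move=> u; have := vle_total (oorder H) u u; rewrite orbb.
  - by rewrite inE size_ordered_vertices (leq_ltn_trans ab).
  - by rewrite inE size_ordered_vertices.
apply/idP/idP => [le_ij|ij]; last exact: le_at.
rewrite leqNgt; apply/negP => ji.
have /(vle_anti (v := oorder H)) /eqP :
    oorder H (vertex_at i) (vertex_at j) && oorder H (vertex_at j) (vertex_at i).
  by rewrite le_ij le_at // ltnW.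
rewrite nth_uniq ?size_ordered_vertices // ?sort_uniq ?enum_uniq // => /eqP ijE.
by rewrite ijE ltnn in ji.
Qed.

Lemma vertex_at_index v : exists2 i, i < #|H| & vertex_at i = v.
Proof.
have vs : v \in ordered_vertices by rewrite mem_sort mem_enum.
by exists (index v ordered_vertices); rewrite /vertex_at ?nth_index // -size_ordered_vertices index_mem.
Qed.

(** Restricted above the diagonal, so that each edge is recorded by a single one and its earlier
    endpoint is the row. *)
Definition adjacency : rel nat := fun x y => (x < y) && (vertex_at x -- vertex_at y).

Lemma edges_le_ones : #|edges H| <= ones #|H| #|H| adjacency.
Proof.
pose P := [set p : 'I_#|H| * 'I_#|H| | adjacency p.1 p.2].
have -> : ones #|H| #|H| adjacency = #|P|.
  rewrite /ones pair_big /= -sum1dep_card [RHS]big_mkcond.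
  by apply: eq_bigr => p _; case: adjacency.
apply: leq_trans (leq_imset_card
  (fun p : 'I_#|H| * 'I_#|H| => [set vertex_at p.1; vertex_at p.2]) P).
apply/subset_leq_card/subsetP => _ /imsetP[[u v] uv ->]; rewrite inE /= in uv.
have [i iH iu] := vertex_at_index u; have [j jH jv] := vertex_at_index v.
have [ij|ji|ijE] := ltngtP i j.
- apply/imsetP; exists (Ordinal iH, Ordinal jH); last by rewrite /= iu jv.
  by rewrite inE /adjacency /= ij iu jv.
- apply/imsetP; exists (Ordinal jH, Ordinal iH); last by rewrite /= iu jv setUC.
  by rewrite inE /adjacency /= ji iu jv sedge_sym.
- by move: uv; rewrite -iu -jv ijE sedge_irr.
Qed.
End Enumeration.

(** * Assembling the embedding into a dense ordered graph *)

Lemma sumn_uphalf_le (T : Type) (cs : seq (seq T)) :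
  sumn [seq uphalf (size c) | c <- cs] <= size (flatten cs).
Proof.
elim: cs => //= c cs IHcs; rewrite size_cat; apply: leq_add IHcs.
by lia.
Qed.

Lemma dense_ograph_contains E : 0 < E ->
  exists C, forall n, 0 < n ->
  forall G : sgraph, #|G| = n -> bipartite G -> max_degree G <= 2 ->
  exists o : vertex_order G,
  forall H : ograph, #|H| = C * n -> (C * n) * (C * n) <= E * #|edges H| ->
    ocontained (OGraph o) H.
Proof.
move=> E_gt0; have D_gt0 : 0 < 4 * E ^ 2 by rewrite muln_gt0 expn_gt0 E_gt0.
have [c chain_dense] := cycle_chain_dense D_gt0.
(* The factor [2 * E] gives [N = 2 * E * L] with [L = c.+1 * n], as [dense_split] requires; [c.+1]
   in place of [c] makes [N] strictly larger than [c] times the sum of the cycle parameters. *)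
exists (2 * E * c.+1) => n n_gt0 G cardG [A A_bip] deg2.
have [cs [cs_gt0 cs_uniq csT cs_link]] :=
  link_decomposition_exists A_bip deg2 (U := setT) (fun x y _ _ => in_setT y).
have all_cs v : v \in flatten cs by rewrite csT inE.
have key_inj : injective (order_key cs).
  by move=> u v; apply: order_key_inj.
(* The order depends only on the decomposition of [G], and is fixed before [H] is given. *)
exists (key_order key_inj) => H cardH dense.
have N_gt0 : 0 < #|H| by rewrite cardH !muln_gt0 E_gt0 n_gt0.
have [x0 _] : exists x0 : H, x0 \in predT by apply/card_gt0P.
have dense1 : #|H| * #|H| <= E * ones #|H| #|H| (adjacency x0).
  rewrite {1 2}cardH; apply: leq_trans dense _.
  by rewrite leq_mul2l edges_le_ones orbT.
have NE : #|H| = 2 * E * (c.+1 * n) by rewrite cardH mulnA.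
have adj_lt x y : adjacency x0 x y -> x < y by case/andP.
have [t dense2] := dense_split N_gt0 NE adj_lt dense1.
pose M x y := [&& adjacency x0 x y, x < t & t <= y].
have size_cs : size (flatten cs) = n.
  rewrite -cardG -(card_uniqP cs_uniq) -cardsT; apply: eq_card => v.
  by rewrite csT.
have [||f [f_lt f_inc f_one f_link]] := cycle_chain_embedding cs_gt0 cs_uniq
  (chain_dense M #|H| [seq uphalf (size c) | c <- cs] _ _ dense2).
- by rewrite all_map; apply: sub_all cs_gt0 => x /=; lia.
- rewrite NE; apply: (@leq_ltn_trans (c * n)).
    by rewrite leq_mul2l -size_cs sumn_uphalf_le orbT.
  by rewrite -mulnA; nia.
have fN v : f v < #|H| by have := f_lt v (all_cs v); case: is_row.
(* A one of [M] has its row before the cut [t] and its column from [t] on, so a nonempty row or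
   column tells on which side [f v] lies. *)
have f_row v : is_row cs v -> f v < t.
  by have := f_one v (all_cs v); case: is_row => // -[z /and3P[]].
have f_col v : ~~ is_row cs v -> t <= f v.
  by have := f_one v (all_cs v); case: is_row => // -[z /and3P[]].
(* Two rows or two columns are compared by rank through [f_inc]; a row and a column are separated by
   [t]. *)
have f_mono u v : order_key cs u < order_key cs v -> f u < f v.
  have := rank_lt (all_cs u); have := rank_lt (all_cs v); rewrite /order_key.
  have := f_inc u v (all_cs u) (all_cs v); have := f_row u; have := f_col v.
  case: (is_row cs u); case: (is_row cs v); lia.
have f_le u v : (f u <= f v) = (order_key cs u <= order_key cs v).
  have [/f_mono/ltnW //|/f_mono|/key_inj ->] := ltngtP (order_key cs u) (order_key cs v).
    by move=> lt_vu; rewrite leqNgt lt_vu.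
  by rewrite leqnn.
apply: (ocontained_of_embedding (h := fun v => vertex_at x0 (f v))).
- move=> u v uv; have [c' [c'cs uc vc lk]] := cs_link u v (in_setT u) uv.
  have [row_uv Muv] := f_link c' u v c'cs uc vc lk.
  have [row_u|col_u] := boolP (is_row cs u).
    by have /and3P[/andP[]] := Muv row_u.
  have row_v : is_row cs v by move: row_uv; rewrite (negPf col_u).
  rewrite link_sym in lk; have [_ /(_ row_v)] := f_link c' v u c'cs vc uc lk.
  by move=> /and3P[/andP[_]]; rewrite sedge_sym.
- by move=> u v; rewrite vertex_at_le // f_le.
Qed.

Import Order.TTheory GRing.Theory Num.Theory.
Local Open Scope ring_scope.

Theorem theorem3p3 (R : realType) (eps : R) (heps : 0 < eps) :
  exists C : nat, forall n : nat, (0 < n)%N ->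
  forall G : sgraph, #|G| = n -> bipartite G -> (max_degree G <= 2)%N ->
  exists o : vertex_order G,
  forall H : ograph, #|H| = (C * n)%N ->
    eps * (C * n)%:R ^+ 2 <= #|edges H|%:R ->
    ocontained (OGraph o) H.
Proof.
(* An integer [E] of size at least $1/\varepsilon$ turns the real density condition into $N^2 \le
   E\,e$ over the naturals, where $e$ is the number of edges. *)
have [E epsE] : exists E : nat, 1 <= E%:R * eps.
  exists (Num.bound eps^-1); rewrite -ler_pdivrMr // div1r.
  by apply: ltW; apply: archi_boundP; rewrite invr_ge0 ltW.
have E_gt0 : (0 < E)%N.
  by case: E epsE => //; rewrite mul0r ler10.
have [C HC] := dense_ograph_contains E_gt0.
exists C => n n_gt0 G cardG bipG degG; have [o Ho] := HC n n_gt0 G cardG bipG degG.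
exists o => H cardH dense; apply: Ho => //.
rewrite mulnn -(ler_nat R) natrX [leRHS]natrM.
apply: le_trans (ler_wpM2l (ler0n R E) dense).
by rewrite mulrA ler_peMl // exprn_ge0.
Qed.
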